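(* Let $g$ be a system of real polynomials in $n$ variables and let $W\subseteq\mathbb R^n$ be a real witness set of $Z_{\mathbb R}(g)$. If another system $f$ of real polynomials in the same variables satisfies $f(p)=0$ for every $p\in W$, then $Z_{\mathbb R}(g)\subseteq Z_{\mathbb R}(f)$ for almost all choices of $W$.
   Context: $Z_{\mathbb R}(g)=\{x\in\mathbb R^n: g(x)=0\}$. It is assumed that $Z_{\mathbb R}(g)=\bigcup_i C_i$ where each $C_i$ is a connected component of $Z_{\mathbb R}(g)$ and is a (real analytic) manifold; each $C_i$ is called a component of $Z_{\mathbb R}(g)$ (there are finitely many for a polynomial system). A real witness set of $Z_{\mathbb R}(g)$ is a finite set $W\subseteq\mathbb R^n$ containing at least one point on each component of $Z_{\mathbb R}(g)$; it is not unique. ''For almost all choices of $W$'' means: for all choices of the points of $W$ on the components outside a set of measure zero, i.e. the point of $W$ chosen on a component $C_i$ avoids a subset of measure zero in $C_i$ (with respect to the natural measure class of the manifold $C_i$) that depends on $f$ and $g$. *)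

(* Defs.v *)
From HB Require Import structures.
From mathcomp Require Import all_boot all_order all_algebra.
From mathcomp Require Import all_classical all_reals all_analysis.
(* The notations of mpoly clash with those of MathComp-Analysis, so they are
   left out: [mpoly n R] is {mpoly R[n]}, [meval v p] is p.@[v], [multinom n]
   is 'X_{1..n} and [bmultinom n N] is 'X_{1..n < N}. *)
From mathcomp Require Import -(notations) mpoly.

Set Implicit Arguments.
Unset Strict Implicit.
Unset Printing Implicit Defensive.

Import Order.TTheory GRing.Theory Num.Theory.
Import numFieldNormedType.Exports.

Local Open Scope classical_set_scope.
Local Open Scope ring_scope.

Section RealZeros.
Variables (R : realType) (n : nat).

Definition real_zeros (g : seq (mpoly n R)) : set 'rV[R]_n :=
  [set x | forall p, p \in g -> meval (x 0) p = 0].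

Definition components (Z : set 'rV[R]_n) : set (set 'rV[R]_n) :=
  connected_component Z @` Z.

Definition real_witness_set (Z W : set 'rV[R]_n) : Prop :=
  finite_set W /\ forall C, components Z C -> C `&` W !=set0.

End RealZeros.

Section RealAnalytic.
Variable R : realType.

Definition power_term n (c : multinom n -> R) (a x : 'rV[R]_n)
    (m : multinom n) : R :=
  c m * \prod_(i < n) (x 0 i - a 0 i) ^+ m i.

(* Absolute convergence makes the order of summation irrelevant, so the value
   of the series can be taken along the partial sums of total degree < N. *)
Definition analytic_at n (phi : 'rV[R]_n -> R) (a : 'rV[R]_n) : Prop :=
  exists c : multinom n -> R, \forall x \near a,
    summable setT (fun m : multinom n => (power_term c a x m)%:E) /\
    (\sum_(m : bmultinom n N) power_term c a x m) @[N --> \oo] --> phi x.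

Definition analytic_on n m (U : set 'rV[R]_n) (F : 'rV[R]_n -> 'rV[R]_m) :
    Prop :=
  forall a, U a -> forall j, analytic_at (fun x => F x 0 j) a.

(* Phi is an analytic diffeomorphism, with inverse Psi, from the open set U
   onto the open set V that carries C `&` U onto V `&` (R^d x {0}). *)
Definition slice_chart n (d : 'I_n.+1) (C U V : set 'rV[R]_n)
    (Phi Psi : 'rV[R]_n -> 'rV[R]_n) : Prop :=
  [/\ open U /\ open V,
      analytic_on U Phi /\ analytic_on V Psi,
      (forall x, U x -> V (Phi x) /\ Psi (Phi x) = x),
      (forall y, V y -> U (Psi y) /\ Phi (Psi y) = y) &
      (forall x, U x ->
         (C x <-> forall i : 'I_n, (d <= i)%N -> Phi x 0 i = 0))].

Definition analytic_submanifold n (C : set 'rV[R]_n) : Prop :=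
  exists d : 'I_n.+1, forall p, C p ->
    exists U V Phi Psi, U p /\ slice_chart d C U V Phi Psi.

Definition slice_coord n (d : 'I_n.+1) (y : 'rV[R]_n) : 'rV[R]_d :=
  \row_(i < d) y 0 (widen_ord (leq_ord d) i).

(* The covering is indexed by a subset D of nat, rather than by nat, because
   in dimension 0 every box has volume 1: there only set0 is null, and it is
   covered by taking D := set0. *)
Definition lebesgue_null d (A : set 'rV[R]_d) : Prop :=
  forall e : R, 0 < e ->
    exists (D : set nat) (l u : nat -> 'rV[R]_d),
      [/\ (forall k i, l k 0 i <= u k 0 i),
          A `<=` \bigcup_(k in D)
                   [set x | forall i, l k 0 i <= x 0 i <= u k 0 i] &
          (\esum_(k in D) (\prod_(i < d) (u k 0 i - l k 0 i))%:E <= e%:E)%E].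

(* Measure zero in the submanifold C: null image in every chart of C. No
   dimension has to be recorded, since every chart of C that meets C has the
   dimension of C. *)
Definition null_in n (C A : set 'rV[R]_n) : Prop :=
  forall (d : 'I_n.+1) U V Phi Psi, slice_chart d C U V Phi Psi ->
    lebesgue_null ((slice_coord d \o Phi) @` (A `&` C `&` U)).

(* P W holds for all choices of the points of W on the components of Z outside
   a set N having measure zero in each component. A witness set may have
   several points on a component; one of them outside N is enough. *)
Definition for_almost_all_witness_sets n (Z : set 'rV[R]_n)
    (P : set 'rV[R]_n -> Prop) : Prop :=
  exists N : set 'rV[R]_n,
    (forall C, components Z C -> null_in C N) /\
    forall W, real_witness_set Z W ->
      (forall C, components Z C -> exists p, [/\ W p, C p & ~ N p]) ->
      P W.

End RealAnalytic.

(* Main.v *)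
(** The exceptional set is the union, over the components [C] of Z(g) that are
    not contained in Z(f), of [C `&` Z(f)], so that every component through a
    non-exceptional zero of [f] is contained in Z(f). In a chart the functions
    [p \o Psi] ([p \in f]) are continuous, and along every line through every
    point they are either zero nearby or nonzero on a punctured neighbourhood,
    since they are limits of a power series in one variable. These two
    properties replace analyticity from there on.
    - If all the [p \o Psi] vanish near one point of [C], they vanish near every
      point, by the identity principle along segments and connectedness of [C].
    - If [h] is not identically zero on a box, its zero set there has Jordan
      content zero, by induction on the dimension: for all but isolated values
      of the first coordinate the slice of the zero set has content zero, and by
      compactness so has the zero set over a short interval around it. *)

Require Import Defs.
From HB Require Import structures.
From mathcomp Require Import all_boot all_order all_algebra.
From mathcomp Require Import all_classical all_reals all_analysis.
From mathcomp Require Import -(notations) mpoly.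
From mathcomp Require Import ring lra zify.
Import Order.TTheory GRing.Theory Num.Theory.
Import numFieldNormedType.Exports.
Local Open Scope classical_set_scope.
Local Open Scope ring_scope.
Set Implicit Arguments.
Unset Strict Implicit.
Unset Printing Implicit Defensive.

(** * Germs of one-variable power series *)

Section PowerGerm.
Variable R : realType.
Implicit Types (phi psi : R -> R) (K : R).

(** A quantitative form of analyticity at 0: the single constant [K] controls the radius, the
    prefactor and the ratio of the error. In this form sums and products are handled by plain
    estimates, without limits. *)
Definition germ_bound phi (b : nat -> R) K :=
  forall s N, `|s| * K <= 1 ->
    `|phi s - \sum_(k < N) b k * s ^+ k| <= K * (K * `|s|) ^+ N.

Definition power_germ phi :=
  exists b : nat -> R, exists2 K, 1 <= K & germ_bound phi b K.

Lemma germ_bound_le phi b K K' :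
  1 <= K -> K <= K' -> germ_bound phi b K -> germ_bound phi b K'.
Proof.
move=> K1 KK' phib s N sK'.
have s0 : 0 <= `|s| by [].
have K0 : 0 <= K by lra.
have sK : `|s| * K <= 1 by apply: le_trans sK'; rewrite ler_wpM2l.
apply: (le_trans (phib s N sK)); apply: ler_pM => //.
  by rewrite exprn_ge0// mulr_ge0.
by rewrite lerXn2r ?nnegrE ?mulr_ge0// ?ler_wpM2r// (le_trans K0).
Qed.

Lemma power_germ_cst c : power_germ (fun=> c).
Proof.
exists (fun k => if k is 0%N then c else 0); exists (1 + `|c|).
  by rewrite lerDl.
move=> s [|N] _.
  by rewrite big_ord0 subr0 expr0 mulr1 lerDr.
rewrite big_ord_recl expr0 mulr1 big1 ?addr0 ?subrr ?normr0; last first.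
  by move=> i _; rewrite mul0r.
by rewrite mulr_ge0// ?exprn_ge0// ?mulr_ge0// addr_ge0.
Qed.

Lemma power_germD phi psi :
  power_germ phi -> power_germ psi -> power_germ (fun s => phi s + psi s).
Proof.
move=> [b [K K1 phib]] [c [L L1 psic]].
exists (fun k => b k + c k); exists (K + L); first by lra.
move=> s N sKL.
have s0 : 0 <= `|s| by [].
under eq_bigr do rewrite mulrDl.
rewrite big_split/= opprD addrACA (le_trans (ler_normD _ _))//.
have sK : `|s| * K <= 1 by nra.
have sL : `|s| * L <= 1 by nra.
rewrite mulrDl lerD//.
- apply: (le_trans (phib s N sK)); rewrite ler_wpM2l//; first lra.
  by rewrite lerXn2r ?nnegrE ?mulr_ge0//; nra.
- apply: (le_trans (psic s N sL)); rewrite ler_wpM2l//; first lra.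
  by rewrite lerXn2r ?nnegrE ?mulr_ge0//; nra.
Qed.

Lemma odd_le_exp3 N : (N.*2.+1 <= 3 ^ N)%N.
Proof. by elim: N => // N IH; rewrite expnS; lia. Qed.

(* The [N]-th partial sum of the Cauchy product is
   [\sum_(i < N) b_i s^i (\sum_(j < N - i) c_j s^j)]. *)
Lemma cauchy_partial_sum (b c : nat -> R) s N :
  \sum_(k < N) (\sum_(i < k.+1) b i * c (k - i)%N) * s ^+ k =
  \sum_(i < N) (b i * s ^+ i) * \sum_(j < N - i) c j * s ^+ j.
Proof.
elim: N => [|N IH]; first by rewrite !big_ord0.
rewrite big_ord_recr/= IH [RHS]big_ord_recr/= subSnn big_ord1.
under [in RHS]eq_bigr => i _.
  rewrite subSn; last exact/ltnW/ltn_ord.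
  rewrite big_ord_recr/= mulrDr; over.
rewrite big_split/= -addrA; congr (_ + _).
rewrite big_ord_recr/= subnn expr0 mulr1 mulrDl; congr (_ + _); last by ring.
rewrite mulr_suml; apply: eq_bigr => i _.
have -> : s ^+ N = s ^+ i * s ^+ (N - i).
  by rewrite -exprD subnKC// ltnW.
ring.
Qed.

(** The error of the Cauchy product is the error of [phi] times [psi], plus the terms of [phi] times
    the errors of truncations of [psi]. In total this is at most
    [K ^ 2 * (2 * N + 1) * (K * |s|) ^ N], and [2 * N + 1 <= 3 ^ N] is absorbed by the new constant
    [3 * K ^ 2]. *)
Lemma power_germM phi psi :
  power_germ phi -> power_germ psi -> power_germ (fun s => phi s * psi s).
Proof.
move=> [b [K0 K01 phib0]] [c [L0 L01 psic0]].
pose K := K0 + L0.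
have K1 : 1 <= K by rewrite /K; lra.
have phib : germ_bound phi b K.
  by apply: germ_bound_le phib0 => //; rewrite /K; lra.
have psic : germ_bound psi c K.
  by apply: germ_bound_le psic0 => //; rewrite /K; lra.
clearbody K; clear K0 K01 phib0 L0 L01 psic0.
exists (fun k => \sum_(i < k.+1) b i * c (k - i)%N); exists (3 * K ^+ 2).
  by nra.
move=> s N sK'.
have s0 : 0 <= `|s| by [].
have sK : `|s| * K <= 1 by nra.
have Ks0 : 0 <= K * `|s| by rewrite mulr_ge0//; lra.
(* A term of the series is the difference of two consecutive errors. *)
have bs i : `|b i * s ^+ i| <= 2 * K * (K * `|s|) ^+ i.
  have -> : b i * s ^+ i = (phi s - \sum_(k < i) b k * s ^+ k) -
                           (phi s - \sum_(k < i.+1) b k * s ^+ k).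
    by rewrite big_ord_recr/=; ring.
  rewrite (le_trans (ler_normB _ _))//.
  have h1 := phib s i sK; have h2 := phib s i.+1 sK.
  have : (K * `|s|) ^+ i.+1 <= (K * `|s|) ^+ i.
    by rewrite exprS ler_piMl ?exprn_ge0//; nra.
  by nra.
rewrite cauchy_partial_sum.
have -> : phi s * psi s - \sum_(i < N) b i * s ^+ i *
            \sum_(j < N - i) c j * s ^+ j =
          (phi s - \sum_(k < N) b k * s ^+ k) * psi s +
          \sum_(i < N) b i * s ^+ i *
            (psi s - \sum_(j < N - i) c j * s ^+ j).
  under [X in _ = _ + X]eq_bigr do rewrite mulrBr.
  by rewrite sumrB -mulr_suml; ring.
(* This is the error bound of the empty partial sum. *)
have psiK : `|psi s| <= K.
  by have := psic s 0%N sK; rewrite big_ord0 subr0 expr0 mulr1.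
apply: (@le_trans _ _ (K ^+ 2 * (N.*2.+1)%:R * (K * `|s|) ^+ N)).
  have -> : K ^+ 2 * (N.*2.+1)%:R * (K * `|s|) ^+ N =
      K * (K * `|s|) ^+ N * K + \sum_(i < N) 2 * K ^+ 2 * (K * `|s|) ^+ N.
    rewrite sumr_const card_ord -natr1 -mul2n natrM -[in RHS]mulr_natl; ring.
  apply: (le_trans (ler_normD _ _)); apply: lerD.
    by rewrite normrM; apply: ler_pM => //; apply: phib.
  apply: (le_trans (ler_norm_sum _ _ _)); apply: ler_sum => i _.
  have -> : 2 * K ^+ 2 * (K * `|s|) ^+ N =
      (2 * K * (K * `|s|) ^+ i) * (K * (K * `|s|) ^+ (N - i)).
    have -> : (K * `|s|) ^+ N = (K * `|s|) ^+ i * (K * `|s|) ^+ (N - i).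
      by rewrite -exprD subnKC// ltnW.
    ring.
  by rewrite normrM; apply: ler_pM => //; apply: psic.
apply: (@le_trans _ _ (K ^+ 2 * (3 ^ N)%:R * (K * `|s|) ^+ N)).
  rewrite ler_wpM2r ?exprn_ge0// ler_wpM2l ?exprn_ge0 ?ler_nat ?odd_le_exp3//.
  by lra.
rewrite natrX -mulrA -exprMn; apply: ler_pM.
- by rewrite exprn_ge0//; lra.
- by rewrite exprn_ge0//; lra.
- by nra.
- by rewrite lerXn2r ?nnegrE//; nra.
Qed.

Lemma power_germ_sum I (r : seq I) (F : I -> R -> R) :
  (forall i, power_germ (F i)) -> power_germ (fun s => \sum_(i <- r) F i s).
Proof.
move=> FG; elim: r => [|i r IH].
  by under eq_fun do rewrite big_nil; exact: power_germ_cst.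
by under eq_fun do rewrite big_cons; exact: power_germD.
Qed.

Lemma power_germ_prod I (r : seq I) (F : I -> R -> R) :
  (forall i, power_germ (F i)) -> power_germ (fun s => \prod_(i <- r) F i s).
Proof.
move=> FG; elim: r => [|i r IH].
  by under eq_fun do rewrite big_nil; exact: power_germ_cst.
by under eq_fun do rewrite big_cons; exact: power_germM.
Qed.

Lemma power_germ_meval n (F : 'I_n -> R -> R) (p : mpoly n R) :
  (forall i, power_germ (F i)) -> power_germ (fun s => meval (F^~ s) p).
Proof.
move=> FG; under eq_fun do rewrite mevalE.
apply: power_germ_sum => m; apply: power_germM; first exact: power_germ_cst.
apply: power_germ_prod => i; elim: (m i) => [|k IH].
  by under eq_fun do rewrite expr0; exact: power_germ_cst.
by under eq_fun do rewrite exprS; exact: power_germM.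
Qed.

Definition null_or_isolated phi (t : R) :=
  (\forall s \near t, phi s = 0) \/ (\forall s \near t, s != t -> phi s != 0).

(** If all coefficients vanish, the error bound tends to 0 with [N], so [phi] is zero near 0.
    Otherwise the first nonzero coefficient [b k] dominates the error of order [k + 1] at small
    nonzero [s]. *)
Lemma power_germ_null_or_isolated phi :
  power_germ phi -> null_or_isolated phi 0.
Proof.
move=> [b [K K1 phib]].
have K0 : 0 < K by lra.
have near_small e : 0 < e -> \forall s \near (0 : R), `|s| * e <= 1.
  move=> e0; near=> s.
  rewrite -ler_pdivlMr// div1r; near: s.
  by apply: (@nbhs0_le R R); rewrite invr_gt0.
have [b0|/existsNP/cid[k0 /eqP bk0]] := pselect (forall k, b k = 0).
  left; near=> s; apply/eqP; rewrite -normr_le0; apply/ler_addgt0Pr => e e0.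
  rewrite add0r.
  (* Here the error is at most [K / 2 ^ N], on a neighbourhood that does not depend on [e]. *)
  have sK : `|s| * (2 * K) <= 1 by near: s; apply: near_small; lra.
  have s0 : 0 <= `|s| by [].
  have [N NK] : exists N, K * (2^-1) ^+ N <= e.
    have /cvgrPdist_le/(_ (e / K)) : (fun N => (2^-1 : R) ^+ N) @ \oo --> (0 : R).
      by apply: cvg_expr; rewrite gtr0_norm; lra.
    move=> /(_ (divr_gt0 e0 K0))[N _ /(_ N (leqnn N))/=].
    rewrite sub0r normrN ger0_norm ?exprn_ge0 ?invr_ge0// ler_pdivlMr// mulrC.
    by exists N.
  have := phib s N _; rewrite big1 ?subr0; last by move=> i _; rewrite b0 mul0r.
  move=> h; apply: (le_trans (h _)); first by nra.
  apply: le_trans NK; rewrite ler_pM2l// lerXn2r ?nnegrE ?mulr_ge0//; lra.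
right.
have exb : exists k, b k != 0 by exists k0.
have [k bk bmin] := ex_minnP exb.
(* A zero at [s] would give [|b k| <= e * |b k| * |s|], hence [1 <= e * |s|]. *)
pose e := K * K ^+ k.+1 / `|b k|.
have bk_gt0 : 0 < `|b k| by rewrite normr_gt0.
have e0 : 0 < e by rewrite divr_gt0// mulr_gt0// exprn_gt0.
near=> s => s_neq0.
have sK : `|s| * K <= 1 by near: s; exact: near_small.
have se : `|s| * (2 * e) <= 1 by near: s; apply: near_small; lra.
have s_gt0 : 0 < `|s| by rewrite normr_gt0.
apply/eqP => phis0.
have := phib s k.+1 sK; rewrite phis0 sub0r normrN big_ord_recr/= big1 ?add0r.
  rewrite normrM normrX exprMn !exprS => h.
  have : `|b k| <= (K * (K * K ^+ k)) * `|s|.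
    rewrite -(ler_pM2r (exprn_gt0 k s_gt0)); apply: (le_trans h).
    by rewrite !mulrA.
  have -> : K * (K * K ^+ k) = e * `|b k| by rewrite /e exprS mulfVK// gt_eqF.
  by nra.
move=> i _; apply/eqP; rewrite mulf_eq0; apply/orP; left.
by apply: contraT => /bmin; rewrite leqNgt ltn_ord.
Unshelve. all: by end_near.
Qed.

End PowerGerm.

(** * Analytic functions: restriction to lines and continuity *)

Section Analytic.
Variable R : realType.

Lemma mx_ballE m n (x y : 'M[R]_(m, n)) (e : R) : 0 < e ->
  ball x e y <-> forall i j, `|x i j - y i j| < e.
Proof. by move=> e0; split=> [[_]|]. Qed.

(** Convergence at [r] bounds the terms there by some [B]; for [|s| <= r / 2] the series is then
    dominated by a geometric one of ratio [|s| / r], with tail at most [2 * B * (|s| / r) ^ N]. *)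
Lemma power_germ_series (phi : R -> R) (b : nat -> R) (r : R) : 0 < r ->
  (forall s, `|s| <= r ->
     (\sum_(k < N) b k * s ^+ k) @[N --> \oo] --> phi s) ->
  power_germ phi.
Proof.
move=> r0 phib.
have [B B0 bB] : exists2 B, 0 < B & forall k, `|b k| * r ^+ k <= B.
  have /phib cr : `|r| <= r by rewrite gtr0_norm.
  have /cvg_seq_bounded[M [_ MP]] : cvgn (fun N => \sum_(k < N) b k * r ^+ k).
    by apply/cvg_ex; exists (phi r).
  exists (2 * (`|M| + 1)); first by rewrite mulr_gt0// ltr_wpDl.
  move=> k; rewrite -[X in _ * X]gtr0_norm ?exprn_gt0// -normrM.
  have -> : b k * r ^+ k =
      \sum_(i < k.+1) b i * r ^+ i - \sum_(i < k) b i * r ^+ i.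
    by rewrite big_ord_recr/=; ring.
  have M1 : M < `|M| + 1 by rewrite (le_lt_trans (ler_norm _))// ltrDl.
  have h N : `|\sum_(k < N) b k * r ^+ k| <= `|M| + 1 by exact: MP.
  by rewrite (le_trans (ler_normB _ _))// mulrDl mul1r lerD.
(* The summand [2 / r] forces [|s| <= r / 2], and [2 * B] is the prefactor of the tail. *)
exists b; exists (1 + 2 * B + 2 / r).
  by rewrite -addrA lerDl addr_ge0// ?divr_ge0 ?mulr_ge0 ?ltW.
set K := 1 + _ + _ => s N sK.
have ir0 : 0 < r^-1 by rewrite invr_gt0.
have s0 : 0 <= `|s| by [].
pose q := `|s| / r.
have q0 : 0 <= q by rewrite divr_ge0// ltW.
have q2 : q <= 2^-1.
  have := mulr_ge0 s0 (ltW B0); rewrite /q; move: sK; rewrite /K !mulrDr mulr1; lra.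
have sr : `|s| <= r.
  have : q * r <= 2^-1 * r by rewrite ler_wpM2r// ltW.
  by rewrite /q divfK ?gt_eqF//; lra.
have term k : `|b k * s ^+ k| <= B * q ^+ k.
  rewrite normrM normrX expr_div_n mulrCA -[leLHS]mulrC ler_wpM2l ?exprn_ge0//.
  by rewrite ler_pdivlMr ?exprn_gt0.
(* Keeping the subtracted power makes the induction on [j] close, since [q <= 1 / 2]. *)
have tail j : `|\sum_(k < N + j) b k * s ^+ k - \sum_(k < N) b k * s ^+ k|
    <= 2 * B * (q ^+ N - q ^+ (N + j)).
  elim: j => [|j IH]; first by rewrite addn0 !subrr normr0 mulr0.
  rewrite addnS big_ord_recr/= addrAC (le_trans (ler_normD _ _))//.
  have h := term (N + j)%N.
  have p0 : 0 <= q ^+ (N + j) by rewrite exprn_ge0.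
  have Bq0 : 0 <= B * q ^+ (N + j) by rewrite mulr_ge0// ltW.
  have : 0 <= B * q ^+ (N + j) * (2^-1 - q) by rewrite mulr_ge0// subr_ge0.
  rewrite exprS; nra.
apply: (@le_trans _ _ (2 * B * q ^+ N)); last first.
  have Kr : r^-1 <= K by rewrite /K; lra.
  apply: ler_pM.
  - by rewrite mulr_ge0 ?ltW.
  - by rewrite exprn_ge0.
  - by rewrite /K; lra.
  - rewrite lerXn2r ?nnegrE//; first by rewrite mulr_ge0 ?(le_trans _ Kr)// ltW.
    by rewrite /q mulrC ler_wpM2r.
apply/ler_addgt0Pr => e e0.
have /cvgrPdist_le/(_ e e0)[M _ /(_ (N + M)%N (leq_addl _ _))/= h] := phib s sr.
have t := tail M.
have -> : phi s - \sum_(k < N) b k * s ^+ k =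
  (\sum_(k < N + M) b k * s ^+ k - \sum_(k < N) b k * s ^+ k) +
  (phi s - \sum_(k < N + M) b k * s ^+ k) by ring.
rewrite (le_trans (ler_normD _ _))// lerD// (le_trans t)// ler_wpM2l//.
  by rewrite mulr_ge0// ltW.
by rewrite gerBl exprn_ge0.
Qed.

Lemma mem_bmultinom n N (m : multinom n) :
  (m \in map val (index_enum (bmultinom n N))) = (mdeg m < N)%N.
Proof.
apply/mapP/idP => [[b _ ->]|mN]; first exact: bmdeg.
by exists (BMultinom mN); rewrite ?mem_index_enum.
Qed.

Lemma uniq_bmultinom n N : uniq (map val (index_enum (bmultinom n N))).
Proof. by rewrite map_inj_uniq ?index_enum_uniq//; exact: val_inj. Qed.

Lemma big_bmultinom_narrow n k N (F : multinom n -> R) : (k <= N)%N ->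
  \sum_(m : bmultinom n N | (mdeg m < k)%N) F m =
  \sum_(m : bmultinom n k) F m.
Proof.
move=> kN.
rewrite -(big_map val (fun m => (mdeg m < k)%N) F) -(big_map val xpredT F).
rewrite -big_filter; apply: perm_big; apply: uniq_perm.
- by rewrite filter_uniq// uniq_bmultinom.
- exact: uniq_bmultinom.
move=> m; rewrite mem_filter !mem_bmultinom.
by case: (ltnP (mdeg m) k) => //= mk; rewrite (leq_trans mk kN).
Qed.

Lemma power_series_along_line n (c : multinom n -> R) (a v : 'rV[R]_n) :
  exists b : nat -> R, forall s N,
  \sum_(m : bmultinom n N) power_term c a (a + s *: v) m =
  \sum_(k < N) b k * s ^+ k.
Proof.
(* The coefficient is the homogeneous part of degree [k] at [v]: the multi-indices of degree below
   [k + 1] but not below [k]. *)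
exists (fun k => \sum_(m : bmultinom n k.+1 | ~~ (mdeg m < k)%N)
           c m * \prod_(i < n) v 0 i ^+ m i).
move=> s; elim=> [|N IH].
  by rewrite big_ord0 big1// => m; have := bmdeg m; rewrite ltn0.
rewrite big_ord_recr/= -IH (bigID (fun m : bmultinom n N.+1 => mdeg m < N)%N)/=.
rewrite big_bmultinom_narrow//; congr (_ + _).
rewrite mulr_suml; apply: eq_bigr => m; rewrite -leqNgt => Nm.
have {Nm} mN : mdeg m = N.
  by apply/eqP; rewrite eqn_leq Nm andbT -ltnS bmdeg.
rewrite /power_term -mulrA; congr (_ * _).
under [LHS]eq_bigr do rewrite !mxE addrAC subrr add0r exprMn mulrC.
by rewrite big_split/= prodrXr -mdegE mN.
Qed.

Lemma analytic_at_line n (phi : 'rV[R]_n -> R) (a v : 'rV[R]_n) :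
  analytic_at phi a -> power_germ (fun s => phi (a + s *: v)).
Proof.
move=> [c /nbhs_ballP[e /= e0 eP]].
have [b bE] := power_series_along_line c a v.
(* [M] bounds every coordinate of [v], and is positive even for [v = 0]. *)
pose M := 1 + \sum_i `|v 0 i|.
have M0 : 0 < M by rewrite ltr_pwDl// sumr_ge0.
apply: (@power_germ_series _ b (e / (2 * M))); first by rewrite divr_gt0 ?mulr_gt0.
move=> s se; have [|_] := eP (a + s *: v).
  apply/mx_ballE => // i j; rewrite !mxE ord1 opprD addNKr normrN normrM.
  have vM : `|v 0 j| <= M.
    by rewrite /M (bigD1 j)//= addrCA lerDl addr_ge0// sumr_ge0.
  have : `|s| * `|v 0 j| <= e / (2 * M) * M by apply: ler_pM.
  have -> : e / (2 * M) * M = e / 2 by field; rewrite gt_eqF.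
  by lra.
by under eq_fun do rewrite bE.
Qed.

(** Constant terms cancel. Any other monomial vanishes at [a], and at [x] it is at most
    [(r * t) ^ |m| <= t * r ^ |m|] because [|m| >= 1] and [t <= 1]. *)
Lemma power_term_dist n (c : multinom n -> R) (a x : 'rV[R]_n) (r t : R) m :
  0 <= r -> 0 <= t <= 1 -> (forall i, `|x 0 i - a 0 i| <= r * t) ->
  `|power_term c a x m - power_term c a a m| <=
  t * `|power_term c a (a + const_mx r) m|.
Proof.
move=> r0 /andP[t0 t1] xa; rewrite /power_term -mulrBr !normrM mulrCA.
rewrite ler_wpM2l//.
have -> : \prod_(i < n) ((a + const_mx r) 0 i - a 0 i) ^+ m i = r ^+ mdeg m.
  rewrite mdegE -prodrXr; apply: eq_bigr => i _.
  by rewrite !mxE addrAC subrr add0r.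
rewrite (ger0_norm (exprn_ge0 _ r0)).
have [/eqP m0|m0] := boolP (mdeg m == 0%N).
  have mi i : m i = 0%N.
    by move/eqP: m0; rewrite mdeg_eq0 => /eqP ->; rewrite mnm0E.
  by rewrite !big1 ?subrr ?normr0 ?mulr_ge0 ?exprn_ge0// => i _; rewrite mi.
have [i mi] : exists i, m i != 0%N.
  apply/existsP; apply: contraR m0; rewrite negb_exists => /forallP m0.
  by rewrite mdegE big1// => i _; apply/eqP; have := m0 i; rewrite negbK.
have -> : \prod_(i < n) (a 0 i - a 0 i) ^+ m i = 0.
  by rewrite (bigD1 i)//= subrr expr0n (negbTE mi) mul0r.
rewrite subr0 normr_prod.
apply: (@le_trans _ _ (\prod_(i < n) (r * t) ^+ m i)).
  apply: ler_prod => j _; rewrite normr_ge0/= normrX lerXn2r ?nnegrE//.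
  by rewrite mulr_ge0.
rewrite prodrXr -mdegE exprMn mulrC ler_wpM2r ?exprn_ge0//.
by rewrite -{2}[t]expr1 ler_wiXn2l// lt0n.
Qed.

Lemma summable_bmultinom n (F : multinom n -> R) :
  summable setT (fun m => (F m)%:E) ->
  exists2 S : R, 0 <= S & forall N, \sum_(m : bmultinom n N) `|F m| <= S.
Proof.
rewrite summableE => Ffin; exists (fine (\esum_(m in setT) `|(F m)%:E|%E)).
  by apply: fine_ge0; apply: esum_ge0.
move=> N; rewrite -lee_fin fineK//; apply: esum_ge.
pose r := map val (index_enum (bmultinom n N)).
exists [set` r]; first by split => //; exact: finite_seq.
rewrite -fsbig_seq ?uniq_bmultinom// big_map -sumEFin.
by apply: lee_sum => m _; rewrite abse_EFin.
Qed.

(** Absolute convergence at the corner [a + (r, ..., r)], with sum at most [S], bounds the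
    difference of the partial sums at [a] and [x] by [t * S], uniformly in [N]; the bound passes to
    the limit. *)
Lemma analytic_at_continuous n (phi : 'rV[R]_n -> R) (a : 'rV[R]_n) :
  analytic_at phi a -> {for a, continuous phi}.
Proof.
move=> [c /nbhs_ballP[e /= e0 eP]].
pose r := e / 2.
have r0 : 0 < r by rewrite /r; lra.
have [|S S0 SP] := @summable_bmultinom n (power_term c a (a + const_mx r)).
  have [] := eP (a + const_mx r) => //.
  apply/mx_ballE => // i j; rewrite !mxE opprD addNKr normrN gtr0_norm//.
  by rewrite /r; lra.
rewrite /continuous_at; apply/(@cvgrPdist_le _ R _ (nbhs a) (nbhs_filter a)) => d d0.
pose t := Num.min 1 (d / (S + 1)).
have t0 : 0 < t by rewrite lt_min ltr01 divr_gt0// ltr_wpDl.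
have t1 : t <= 1 by rewrite ge_min lexx.
have tS : t * S <= d.
  apply: (@le_trans _ _ (t * (S + 1))); first by rewrite ler_pM2l// lerDl.
  by rewrite -ler_pdivlMr ?ltr_wpDl// ge_min lexx orbT.
have rt0 : 0 < r * t by rewrite mulr_gt0.
apply/nbhs_ballP; exists (r * t) => //= x /(mx_ballE _ _ rt0) xa.
have [_ cx] : summable setT (fun m : multinom n => (power_term c a x m)%:E) /\
    (\sum_(m : bmultinom n N) power_term c a x m) @[N --> \oo] --> phi x.
  apply: eP; apply/mx_ballE => // i j; apply: (lt_le_trans (xa i j)).
  by rewrite /r; nra.
have [_ ca] := eP _ (ballxx a e0).
have cxa : `|\sum_(m : bmultinom n N) power_term c a a m -
             \sum_(m : bmultinom n N) power_term c a x m| @[N --> \oo]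
           --> `|phi a - phi x|.
  exact: cvg_norm (cvgB ca cx).
apply: le_trans tS.
apply: (cvgr_to_le cxa); apply: nearW => N /=.
rewrite -sumrB (le_trans (ler_norm_sum _ _ _))//.
apply: (@le_trans _ _ (t * \sum_(m : bmultinom n N)
    `|power_term c a (a + const_mx r) m|)); last by rewrite (ler_pM2l t0).
rewrite mulr_sumr; apply: ler_sum => m _.
rewrite distrC; apply: power_term_dist; rewrite ?t1 ?ltW// => i.
by rewrite distrC ltW.
Qed.

End Analytic.

(** * From local to global on a segment *)

Section Segment.
Variable R : realType.
Implicit Types (a b t x y z : R) (phi : R -> R).

(* Cousin's lemma *)
Lemma segment_local_to_global (G : R -> R -> Prop) a b : a < b ->
  (forall x y z, a <= x -> x < y -> y < z -> z <= b ->
     G x y -> G y z -> G x z) ->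
  (forall t, a <= t <= b -> exists2 d, 0 < d &
     forall x y, a <= x -> x < y -> y <= b ->
       `|x - t| < d -> `|y - t| < d -> G x y) ->
  G a b.
Proof.
move=> ab Gtrans Gloc.
pose P d t := forall x y, a <= x -> x < y -> y <= b ->
  `|x - t| < d -> `|y - t| < d -> G x y.
(* By compactness one radius serves for all points of the segment, as a Lebesgue number does. *)
have nearP : \forall d \near 0^'+, `[a, b] `<=` P d.
  have /compact_near_coveringP := @segment_compact R a b; apply.
  move=> t /=; rewrite in_itv/= => /Gloc[d d0 dP].
  exists (ball t (d / 2), [set e | e < d / 2]) => /=.
    split; first by apply: nbhsx_ballx; lra.
    by apply: nbhs_right_lt; lra.
  move=> [t' e]/= [tt' ed] x y ax xy yb xt yt.
  move: tt'; rewrite /ball/= => tt'.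
  apply: dP => //.
    by have := ler_distD t' x t; rewrite [`|t' - t|]distrC; lra.
  by have := ler_distD t' y t; rewrite [`|t' - t|]distrC; lra.
have [d [d0 dP]] : exists d, 0 < d /\ `[a, b] `<=` P d.
  apply: (@filter_ex _ 0^'+); near=> d; split; last by near: d.
  by near: d; exact: nbhs_right_gt.
have ba0 : 0 < b - a by rewrite subr_gt0.
(* The segment is cut into [N] equal steps of length [h < d], which are then concatenated. *)
pose N := (Num.truncn ((b - a) / d)).+1.
pose h := (b - a) / N%:R.
have N0 : 0 < N%:R :> R by rewrite ltr0n.
have hN : h * N%:R = b - a by rewrite /h divfK// gt_eqF.
have h0 : 0 < h by rewrite divr_gt0.
have hd : h < d.
  by rewrite /h ltr_pdivrMr// mulrC -ltr_pdivrMr// truncnS_gt.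
have Gk k : (0 < k <= N)%N -> G a (a + h * k%:R).
  elim: k => // -[_ _|k IH kN].
    have hN1 : h <= h * N%:R by rewrite -[leLHS]mulr1 ler_pM2l// ler1n.
    rewrite mulr1; apply: (dP a).
    - by rewrite /= in_itv/= lexx ltW.
    - exact: lexx.
    - by rewrite ltrDl.
    - by rewrite -lerBrDl -hN.
    - by rewrite subrr normr0.
    - by rewrite addrAC subrr add0r gtr0_norm.
  have kN' : h * k.+2%:R <= h * N%:R by rewrite ler_pM2l// ler_nat.
  have k0 : 0 < h * k.+1%:R by rewrite mulr_gt0.
  have kE : h * k.+2%:R = h * k.+1%:R + h by rewrite -natr1 mulrDr mulr1.
  have kb : a + h * k.+1%:R <= b by lra.
  have st : a + h * k.+1%:R < a + h * k.+2%:R by lra.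
  apply: (Gtrans _ (a + h * k.+1%:R)) => //.
  - by lra.
  - by lra.
  - by apply: IH => /=; lia.
  - apply: (dP (a + h * k.+1%:R)).
    + by rewrite /= in_itv/= kb andbT lerDl ltW.
    + by rewrite lerDl ltW.
    + exact: st.
    + by lra.
    + by rewrite subrr normr0.
    + have -> : a + h * k.+2%:R - (a + h * k.+1%:R) = h by rewrite kE; ring.
      by rewrite gtr0_norm.
have := Gk N; rewrite hN addrC subrK; apply.
by rewrite /= leqnn.
Unshelve. all: by end_near.
Qed.

Lemma null_or_isolated_shift phi t :
  null_or_isolated (fun s => phi (t + s)) 0 -> null_or_isolated phi t.
Proof.
have sh (P : set R) : (\forall s \near 0, P (t + s)) -> \forall s \near t, P s.
  move=> /nbhs_ballP[e /= e0 eP]; apply/nbhs_ballP; exists e => //= s ts.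
  rewrite -[s](subrKC t); apply: eP.
  by move: ts; rewrite /ball/= sub0r normrN distrC.
case=> [h|h]; [left|right]; apply: sh => //.
apply: filterS h => s h ts; apply: h; apply: contraNneq ts => ->.
by rewrite addr0.
Qed.

(** Being null near a point is locally constant along the segment: around a point of the first
    alternative it holds everywhere, around one of the second it holds nowhere. *)
Lemma identity_on_segment phi :
  (forall t, 0 <= t <= 1 -> null_or_isolated phi t) ->
  (\forall s \near 0, phi s = 0) -> phi 1 = 0.
Proof.
move=> phiP phi0; apply: (@nbhs_singleton _ _ [set s | phi s = 0]).
suff [+ _] : (\forall s \near (0 : R), phi s = 0) <-> (\forall s \near (1 : R), phi s = 0).
  exact.
pose G x y := (\forall s \near x, phi s = 0) <-> (\forall s \near y, phi s = 0).
apply: (@segment_local_to_global G 0 1) => //.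
  by move=> x y z _ _ _ _; rewrite /G => ->.
move=> t /phiP[|] /=.
  move=> /nbhs_interior/nbhs_ballP[d /= d0 dP].
  exists d => // x y _ _ _ xt yt; rewrite /G.
  by split=> _; apply: dP; rewrite /ball/= distrC.
move=> /nbhs_ballP[d /= d0 dP]; exists d => // x y _ _ _ xt yt.
have nonnull z : `|z - t| < d -> ~ \forall s \near z, phi s = 0.
  move=> zt z0; have [ztE|zNt] := eqVneq z t; last first.
    have /eqP := nbhs_singleton z0; apply/negP; apply: dP => //.
    by rewrite /ball/= distrC.
  subst z; have : \forall s \near t^', False.
    have tb : \forall s \near t, ball t d s by exact: nbhsx_ballx.
    near=> s; have st : s != t by near: s; exact: nbhs_dnbhs_neq.
    have /eqP : phi s = 0 by near: s; exact: nbhs_dnbhs.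
    apply/negP; apply: dP => //; near: s; exact: nbhs_dnbhs.
  by move/filter_ex => [].
by split=> [/nonnull|/nonnull].
Unshelve. all: by end_near.
Qed.

End Segment.

(** * Zero sets in boxes *)

Section Content.
Variable R : realType.

Definition box d (l u : 'rV[R]_d) : set 'rV[R]_d :=
  [set x | forall i, l 0 i <= x 0 i <= u 0 i].

Definition open_box d (l u : 'rV[R]_d) : set 'rV[R]_d :=
  [set x | forall i, l 0 i < x 0 i < u 0 i].

Definition volume d (l u : 'rV[R]_d) : R := \prod_(i < d) (u 0 i - l 0 i).

(** A bound on the outer Jordan content. The boxes are open so that a cover of one slice can serve
    for neighbouring slices. *)
Definition content_le d (A : set 'rV[R]_d) (v : R) :=
  exists s : seq ('rV[R]_d * 'rV[R]_d),
    [/\ forall b, b \in s -> forall i, b.1 0 i <= b.2 0 i,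
        forall x, A x -> exists2 b, b \in s & open_box b.1 b.2 x &
        \sum_(b <- s) volume b.1 b.2 <= v].

Lemma content_le_sub d (A B : set 'rV[R]_d) v w :
  A `<=` B -> v <= w -> content_le B v -> content_le A w.
Proof.
move=> AB vw [s [sle sB sv]]; exists s; split=> //; last exact: le_trans vw.
by move=> x /AB; exact: sB.
Qed.

Lemma content_le0 d : content_le (@set0 'rV[R]_d) 0.
Proof. by exists [::]; split=> //; rewrite big_nil. Qed.

Lemma content_leU d (A B : set 'rV[R]_d) v w :
  content_le A v -> content_le B w -> content_le (A `|` B) (v + w).
Proof.
move=> [s [sle sA sv]] [r [rle rB rw]]; exists (s ++ r); split.
- by move=> b; rewrite mem_cat => /orP[/sle|/rle].
- move=> x [/sA[b bs bx]|/rB[b br bx]]; exists b => //; rewrite mem_cat ?bs//.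
  by rewrite br orbT.
- by rewrite big_cat lerD.
Qed.

Lemma content_le_box d (A : set 'rV[R]_d) (l u : 'rV[R]_d) :
  (forall i, l 0 i <= u 0 i) -> A `<=` open_box l u ->
  content_le A (volume l u).
Proof.
move=> lu Alu; exists [:: (l, u)]; split; last by rewrite big_seq1.
  by move=> b; rewrite inE => /eqP ->.
by move=> x /Alu lux; exists (l, u); rewrite ?inE.
Qed.

Lemma open_box_open d (l u : 'rV[R]_d) : open (open_box l u).
Proof.
rewrite openE => x lux.
apply: (@filter_forall _ _ (fun i y => l 0 i < y 0 i < u 0 i) (nbhs x)) => i.
have /andP[lx xu] := lux i; have cx := @coord_continuous R 1 d 0 i x.
near=> y; apply/andP; split; near: y.
  exact: (cvgr_gt _ cx _ lx).
exact: (cvgr_lt _ cx _ xu).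
Unshelve. all: by end_near.
Qed.

Lemma box_compact d (l u : 'rV[R]_d) : compact (box l u).
Proof.
have := @rV_compact R d (fun i => `[l 0 i, u 0 i]%classic).
rewrite /box /= => /(_ (fun i => @segment_compact _ _ _)).
by congr compact; apply/seteqP; split=> x /= h i; have := h i; rewrite in_itv.
Qed.

Definition cons_row d (t : R) (y : 'rV[R]_d) : 'rV[R]_(1 + d) :=
  row_mx (const_mx t) y.

Lemma cons_rowP d (x : 'rV[R]_(1 + d)) : exists t y, x = cons_row t y.
Proof.
exists (x 0 (lshift d ord0)), (rsubmx x).
rewrite -[LHS]hsubmxK /cons_row; congr row_mx.
by apply/rowP => i; rewrite !mxE !ord1.
Qed.

Lemma box_cons_row d a b t (l u y : 'rV[R]_d) :
  box (cons_row a l) (cons_row b u) (cons_row t y) <->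
  a <= t <= b /\ box l u y.
Proof.
split=> [h|[tab luy] i].
  split; first by have := h (lshift d ord0); rewrite !row_mxEl !mxE.
  by move=> i; have := h (rshift 1 i); rewrite !row_mxEr.
by case: (splitP i) => j ij; [have -> : i = lshift d j|have -> : i = rshift 1 j];
  rewrite ?row_mxEl ?row_mxEr ?mxE//; exact: val_inj.
Qed.

Lemma open_box_cons_row d a b t (l u y : 'rV[R]_d) :
  a < t < b -> open_box l u y ->
  open_box (cons_row a l) (cons_row b u) (cons_row t y).
Proof.
move=> tab luy i.
by case: (splitP i) => j ij; [have -> : i = lshift d j|have -> : i = rshift 1 j];
  rewrite ?row_mxEl ?row_mxEr ?mxE//; exact: val_inj.
Qed.

Lemma le_cons_row d a b (l u : 'rV[R]_d) : a <= b ->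
  (forall i, l 0 i <= u 0 i) ->
  forall i, (cons_row a l) 0 i <= (cons_row b u) 0 i.
Proof.
move=> ab lu i.
by case: (splitP i) => j ij; [have -> : i = lshift d j|have -> : i = rshift 1 j];
  rewrite ?row_mxEl ?row_mxEr ?mxE//; exact: val_inj.
Qed.

Lemma volume_cons_row d a b (l u : 'rV[R]_d) :
  volume (cons_row a l) (cons_row b u) = (b - a) * volume l u.
Proof.
rewrite /volume big_split_ord/= big_ord1 !row_mxEl !mxE; congr (_ * _).
by apply: eq_bigr => i _; rewrite !row_mxEr.
Qed.

Lemma ball_cons_row d t t' (y y' : 'rV[R]_d) e : 0 < e ->
  ball t e t' -> ball y e y' -> ball (cons_row t y) e (cons_row t' y').
Proof.
move=> e0 tt' /(mx_ballE _ _ e0) yy'; apply/(mx_ballE _ _ e0) => i j.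
by case: (splitP j) => k jk; [have -> : j = lshift d k|have -> : j = rshift 1 k];
  rewrite ?row_mxEl ?row_mxEr ?mxE//; exact: val_inj.
Qed.

Lemma cons_row_line d t t' (y y' : 'rV[R]_d) s :
  cons_row t y + s *: cons_row t' y' = cons_row (t + s * t') (y + s *: y').
Proof.
rewrite /cons_row scale_row_mx add_row_mx; congr row_mx.
by apply/rowP => i; rewrite !mxE.
Qed.

(** Both conditions are inherited by slices, as the induction on the dimension requires. *)
Definition tame_at d (h : 'rV[R]_d -> R) (x : 'rV[R]_d) :=
  {for x, continuous h} /\
  forall v, null_or_isolated (fun s => h (x + s *: v)) 0.

Lemma tame_identity d (h : 'rV[R]_d -> R) (x z : 'rV[R]_d) :
  (forall s, 0 <= s <= 1 -> tame_at h (x + s *: (z - x))) ->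
  (\forall s \near 0, h (x + s *: (z - x)) = 0) -> h z = 0.
Proof.
move=> hP h0; rewrite -[z](subrKC x) -[z - x]scale1r.
apply: (@identity_on_segment _ (fun s => h (x + s *: (z - x)))) => // t t01.
apply: null_or_isolated_shift.
have [_ /(_ (z - x))] := hP _ t01; congr null_or_isolated.
by apply/funext => s; rewrite scalerDl addrA.
Qed.

Lemma tame_slice d (h : 'rV[R]_(1 + d) -> R) t (y : 'rV[R]_d) :
  tame_at h (cons_row t y) -> tame_at (fun y => h (cons_row t y)) y.
Proof.
move=> [hc hi]; split=> [|v].
  apply: (@continuous_comp _ _ _ (cons_row t) h) => //.
  move=> A /nbhs_ballP[e /= e0 eA]; apply/nbhs_ballP; exists e => //= y' yy'.
  by apply: eA; apply: ball_cons_row => //; exact: ballxx.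
have := hi (cons_row 0 v); congr null_or_isolated.
by apply/funext => s; rewrite cons_row_line mulr0 addr0.
Qed.

Definition zero_slab d (h : 'rV[R]_(1 + d) -> R) (l u : 'rV[R]_d) s1 s2 :=
  [set x | exists t y, [/\ x = cons_row t y, s1 <= t <= s2, box l u y &
                           h x = 0]].

(* The zeros of [h] on a slice [t = const] lie in the union [O] of finitely many
   open boxes of small volume; by compactness the zeros on nearby slices lie in
   [O] too, hence the zeros over a short interval of length [w] have content at
   most [2 w] times the volume of [O]. *)
Lemma zero_slab_local d (h : 'rV[R]_(1 + d) -> R) (l u : 'rV[R]_d) a b t e :
  0 < e -> a <= t <= b ->
  (forall s y, a <= s <= b -> box l u y -> tame_at h (cons_row s y)) ->
  content_le [set y | box l u y /\ h (cons_row t y) = 0] (e / 2) ->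
  exists2 r, 0 < r & forall x y, a <= x -> x < y -> y <= b ->
    `|x - t| < r -> `|y - t| < r ->
    content_le (zero_slab h l u x y) (e * (y - x)).
Proof.
move=> e0 tab hP [s [sle sP sv]].
pose P t' y := a <= t' <= b -> h (cons_row t' y) = 0 ->
  exists2 b, b \in s & open_box b.1 b.2 y.
have : \forall t' \near t, box l u `<=` P t'.
  have /compact_near_coveringP cov := @box_compact d l u.
  apply: (cov R (nbhs t) P (nbhs_filter t)) => y luy.
  (* Near a zero, its covering box works for every [t']; near a nonzero point, continuity excludes
     zeros. *)
  have [hy|hy] := eqVneq (h (cons_row t y)) 0.
    have [b' b's b'y] := sP y (conj luy hy).
    exists (open_box b'.1 b'.2, setT) => /=.
      split; last exact: filterT.
      by apply: open_nbhs_nbhs; split=> //; exact: open_box_open.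
    by move=> [y' t'] /= [b'y' _] _ _; exists b'.
  have [hc _] := hP t y tab luy.
  have : nbhs (cons_row t y) [set x | h x != 0].
    exact: (cvgr_neq0 _ hc hy).
  move=> /nbhs_ballP[r /= r0 rP]; exists (ball y r, ball t r) => /=.
    by split; exact: nbhsx_ballx.
  move=> [y' t'] /= [yy' tt'] _ /eqP h0; exfalso; move: h0; apply/negP.
  by apply: rP; apply: ball_cons_row.
move=> /nbhs_ballP[r /= r0 rP]; exists r => // x y ax xy yb xt yt.
(* Widening by [w] on both sides puts the end slices inside open boxes; it doubles the length, which
   the bound [e / 2] on the slice compensates. *)
pose w := (y - x) / 2; have w0 : 0 < w by rewrite /w; lra.
exists [seq (cons_row (x - w) b.1, cons_row (y + w) b.2) | b <- s]; split.
- move=> _ /mapP[b' b's ->] /=; apply: le_cons_row; first by lra.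
  exact: sle.
- move=> _ [t' [z [-> /andP[xt' t'y] luz hz]]].
  have [||b' b's b'z] := rP t' _ z luz _ hz.
  + by rewrite /ball/= ltr_distlC; move: xt yt; rewrite !ltr_distl; lra.
  + by apply/andP; split; lra.
  exists (cons_row (x - w) b'.1, cons_row (y + w) b'.2).
    by apply/mapP; exists b'.
  by apply: open_box_cons_row => //=; apply/andP; split; lra.
- rewrite big_map; under eq_bigr do rewrite volume_cons_row.
  rewrite -mulr_sumr; apply: (@le_trans _ _ ((y + w - (x - w)) * (e / 2))).
    by rewrite ler_wpM2l//; lra.
  by rewrite /w; lra.
Qed.

End Content.

Section ZeroContent.
Variable R : realType.

Lemma zero_slab_split d (h : 'rV[R]_(1 + d) -> R) l u x y z :
  zero_slab h l u x z `<=` zero_slab h l u x y `|` zero_slab h l u y z.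
Proof.
move=> _ [t [q [-> /andP[xt tz] luq hq]]].
have [ty|yt] := leP t y; [left|right]; exists t, q; split=> //.
  by rewrite xt.
by rewrite ltW.
Qed.

(** A bound proportional to the length of the interval is additive, so the local bounds add up to
    [e]. *)
Lemma zero_slab_regular d (h : 'rV[R]_(1 + d) -> R) (l u : 'rV[R]_d) s1 s2 e :
  s1 < s2 -> 0 < e ->
  (forall s y, s1 <= s <= s2 -> box l u y -> tame_at h (cons_row s y)) ->
  (forall s e', s1 <= s <= s2 -> 0 < e' ->
     content_le [set y | box l u y /\ h (cons_row s y) = 0] e') ->
  content_le (zero_slab h l u s1 s2) e.
Proof.
move=> s12 e0 hP hs; have d0 : 0 < s2 - s1 by rewrite subr_gt0.
have -> : e = (e / (s2 - s1)) * (s2 - s1) by rewrite divfK ?gt_eqF.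
have e'0 : 0 < e / (s2 - s1) by rewrite divr_gt0.
apply: (@segment_local_to_global _ (fun x y =>
  content_le (zero_slab h l u x y) (e / (s2 - s1) * (y - x)))) => //.
  move=> x y z _ _ _ _ xy yz.
  apply: (content_le_sub _ _ (content_leU xy yz)).
    exact: zero_slab_split.
  by rewrite -mulrDr [X in _ * X](_ : _ = z - x)//; ring.
move=> t t12; apply: zero_slab_local => //.
by apply: hs => //; rewrite divr_gt0.
Qed.

(** Nothing is asked of [h]: this absorbs the exceptional slices, on which [h] may vanish
    identically. *)
Lemma zero_slab_thin d (h : 'rV[R]_(1 + d) -> R) (l u : 'rV[R]_d) t e :
  0 < e -> (forall i, l 0 i <= u 0 i) ->
  exists2 r, 0 < r & forall r', 0 < r' -> r' <= r ->
    content_le (zero_slab h l u (t - r') (t + r')) e.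
Proof.
move=> e0 lu; pose l' := l - const_mx 1; pose u' := u + const_mx 1.
have V0 : 0 < volume l' u'.
  apply: prodr_gt0 => i _; rewrite !mxE; have := lu i; lra.
(* A box of width [4 * r] over the enlarged base has volume [e]. *)
pose r := e / (4 * volume l' u').
have r0 : 0 < r by rewrite divr_gt0 ?mulr_gt0.
have rE : 4 * r * volume l' u' = e.
  by rewrite /r mulrAC mulrC divfK// gt_eqF// mulr_gt0.
exists r => // r' r'0 r'r.
have lu' i : l' 0 i <= u' 0 i by rewrite !mxE; have := lu i; lra.
have cov : zero_slab h l u (t - r') (t + r') `<=`
    open_box (cons_row (t - 2 * r) l') (cons_row (t + 2 * r) u').
  move=> _ [s [y [-> /andP[st ts] luy _]]]; apply: open_box_cons_row.
    by apply/andP; split; lra.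
  by move=> i; rewrite !mxE; have := luy i => /andP[]; lra.
apply: (content_le_sub (@subset_refl _ _) _ (content_le_box _ cov)).
  by rewrite volume_cons_row -rE ler_pM2r//; lra.
by apply: le_cons_row => //; lra.
Qed.

(** Fix [(t0, y0)] with [h] nonzero there. Zeros on the line through it in the first direction are
    isolated, since otherwise the identity principle would carry a null germ to [t0]. A slice
    meeting this line in a nonzero point falls under the induction hypothesis; thin slabs cover the
    others. *)
Lemma zero_set_content d (h : 'rV[R]_d -> R) (l u : 'rV[R]_d) e :
  (forall i, l 0 i < u 0 i) -> (forall x, box l u x -> tame_at h x) ->
  (exists2 x, box l u x & h x != 0) -> 0 < e ->
  content_le [set x | box l u x /\ h x = 0] e.
Proof.
elim: d => [|d IH] in h l u e *.
  (* In dimension 0 the only point is the one where [h] is nonzero. *)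
  move=> _ _ [x _ hx] e0; apply: (content_le_sub _ _ (content_le0 R 0)).
    move=> y [_ hy]; have xy : x = y by apply/rowP => -[].
    by move: hx; rewrite xy hy eqxx.
  exact: ltW.
have {}IH : forall (h : 'rV[R]_d -> R) (l u : 'rV[R]_d) e,
  (forall i, l 0 i < u 0 i) -> (forall x, box l u x -> tame_at h x) ->
  (exists2 x, box l u x & h x != 0) -> 0 < e ->
  content_le [set x | box l u x /\ h x = 0] e by exact: IH.
rewrite -[d.+1]/(1 + d)%N in h l u *.
have [a [l' ->]] := cons_rowP l; have [b [u' ->]] := cons_rowP u.
move=> {l u} lu hP [x]; have [t0 [y0 ->]] := cons_rowP x.
move=> /box_cons_row[t0ab luy0] hx e0.
have ab : a < b.
  by have := lu (lshift d ord0); rewrite !row_mxEl !mxE.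
have lu' i : l' 0 i < u' 0 i by have := lu (rshift 1 i); rewrite !row_mxEr.
have tame s y : a <= s <= b -> box l' u' y -> tame_at h (cons_row s y).
  by move=> sab luy; apply: hP; apply/box_cons_row.
have slice s e' : a <= s <= b -> h (cons_row s y0) != 0 -> 0 < e' ->
    content_le [set y | box l' u' y /\ h (cons_row s y) = 0] e'.
  move=> sab hs e'0; apply: (IH (fun y => h (cons_row s y))) => //.
    by move=> y luy; apply: tame_slice; exact: tame.
  by exists y0.
have regular s1 s2 e' : a <= s1 -> s2 <= b -> s1 < s2 -> 0 < e' ->
    (forall s, s1 <= s <= s2 -> h (cons_row s y0) != 0) ->
    content_le (zero_slab h l' u' s1 s2) e'.
  move=> as1 s2b s12 e'0 hs; apply: zero_slab_regular => //.
    by move=> s y /andP[? ?] luy; apply: tame => //; lra.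
  by move=> s e'' s12' e''0; apply: slice => //; [lra | exact: hs].
have isolated t : a <= t <= b ->
    exists2 r, 0 < r & forall s, `|s - t| < r -> s != t ->
      h (cons_row s y0) != 0.
  move=> tab.
  have lineE s v : cons_row t y0 + s *: cons_row v (0 : 'rV_d) =
      cons_row (t + s * v) y0 by rewrite cons_row_line scaler0 addr0.
  have [_ /(_ (cons_row 1 0))] := tame t y0 tab luy0.
  have -> : (fun s => h (cons_row t y0 + s *: cons_row 1 0)) =
            (fun s => h (cons_row (t + s) y0)).
    by apply/funext => s; rewrite lineE mulr1.
  move=> /(@null_or_isolated_shift _ (fun s => h (cons_row s y0)))[h0|].
    have zE : cons_row t0 y0 - cons_row t y0 = cons_row (t0 - t) 0.
      by rewrite -scaleN1r cons_row_line mulN1r scaleN1r subrr.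
    suff : h (cons_row t0 y0) = 0 by move/eqP: hx.
    apply: (@tame_identity _ _ _ (cons_row t y0)) => [s s01|].
      rewrite zE lineE; apply: tame => //.
      by move: tab t0ab s01 => /andP[? ?] /andP[? ?] /andP[? ?]; nra.
    have ct : (fun s : R => t + s * (t0 - t)) @ (0 : R) --> t + 0 * (t0 - t).
      apply: (@cvgD _ _ _ (nbhs (0 : R)) _); first exact: cvg_cst.
      by apply: cvgM; [exact: cvg_id|exact: cvg_cst].
    rewrite mul0r addr0 in ct.
    rewrite zE.
    apply: (@filterS _ (nbhs (0 : R)) _ _ _ _ (ct _ h0)) => s /=.
    by rewrite lineE.
  move=> /nbhs_ballP[r /= r0 rP]; exists r => // s st; apply: rP.
  by rewrite /ball/= distrC.
suff /(_ e e0) : forall e', 0 < e' -> content_le (zero_slab h l' u' a b) e'.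
  apply: content_le_sub => // x'; have [t [y ->]] := cons_rowP x'.
  by move=> [/box_cons_row[tab luy] hty]; exists t, y.
(* With all [e'] at once, the property is stable under concatenation by halving [e']. *)
apply: (@segment_local_to_global _ (fun x y => forall e', 0 < e' ->
  content_le (zero_slab h l' u' x y) e')) => //.
  move=> x' y' z' _ _ _ _ xy yz e' e'0.
  have e'2 : 0 < e' / 2 by rewrite divr_gt0.
  apply: (content_le_sub _ _ (content_leU (xy _ e'2) (yz _ e'2))).
    exact: zero_slab_split.
  by rewrite -splitr.
move=> t tab; have [r r0 rP] := isolated t tab.
exists r => // x' y' ax xy yb xt yt e' e'0.
have e'3 : 0 < e' / 3 by rewrite divr_gt0.
have [r1 r10 thin] := @zero_slab_thin _ h l' u' t _ e'3 (fun i => ltW (lu' i)).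
pose A := zero_slab h l' u' x' (t - r1).
pose C := zero_slab h l' u' (t + r1) y'.
(* The interval is split into a thin slab around [t] and a regular piece on each side; a side piece
   is dropped when the slab already reaches the end of the interval. *)
have lef : content_le (if x' < t - r1 then A else set0) (e' / 3).
  case: ifPn => [xt1|_]; last first.
    exact: (content_le_sub _ (ltW e'3) (content_le0 R (1 + d))).
  apply: regular => //; first by move: tab => /andP[? ?]; lra.
  move=> s /andP[? ?]; apply: rP; last by rewrite lt_eqF//; lra.
  by move: xt; rewrite !ltr_distl => /andP[? ?]; lra.
have rig : content_le (if t + r1 < y' then C else set0) (e' / 3).
  case: ifPn => [xt1|_]; last first.
    exact: (content_le_sub _ (ltW e'3) (content_le0 R (1 + d))).
  apply: regular => //; first by move: tab => /andP[? ?]; lra.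
  move=> s /andP[? ?]; apply: rP; last by rewrite gt_eqF//; lra.
  by move: yt; rewrite !ltr_distl => /andP[? ?]; lra.
have mid := thin r1 r10 (lexx _).
apply: (content_le_sub _ _ (content_leU (content_leU lef mid) rig)); last lra.
move=> _ [s [q [-> /andP[xs sy] luq hq]]].
have [st|st] := ltP s (t - r1).
  by left; left; rewrite (le_lt_trans xs st); exists s, q; split; rewrite ?xs ?ltW.
have [st'|st'] := ltP (t + r1) s.
  by right; rewrite (lt_le_trans st' sy); exists s, q; split; rewrite ?sy ?andbT ?ltW.
by left; right; exists s, q; split; rewrite ?st.
Qed.

End ZeroContent.

(** * From content zero to measure zero *)

Section NullSets.
Variable R : realType.

Lemma lebesgue_null_bigcup d (A : nat -> set 'rV[R]_d) (B : set 'rV[R]_d) :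
  (forall k e, 0 < e -> content_le (A k) e) -> B `<=` \bigcup_k A k ->
  lebesgue_null B.
Proof.
move=> A0 BA e e0.
have e2 k : 0 < e / (2 ^ k.+1)%:R by rewrite divr_gt0// ltr0n expn_gt0.
have [s sP] := choice (fun k => A0 k _ (e2 k)).
(* Box [j] of the cover of [A k] gets the index [pickle (k, j)]. Past the end of a list [nth] gives
   a degenerate box, so bounds stay ordered at every index, but only codes of actual boxes are
   summed. *)
pose N := [set x : nat * nat | (x.2 < size (s x.1))%N].
pose b (x : nat * nat) := nth (0, 0) (s x.1) x.2.
pose dec i : nat * nat := odflt (0, 0)%N (unpickle i).
have decK x : dec (pickle x) = x by rewrite /dec pickleK.
exists (pickle @` N), (fun i => (b (dec i)).1), (fun i => (b (dec i)).2).
have b_le x i : (b x).1 0 i <= (b x).2 0 i.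
  rewrite /b; have [xs|xs] := ltnP x.2 (size (s x.1)); last by rewrite nth_default.
  by have [sle _ _] := sP x.1; apply: sle; exact: mem_nth.
split=> //.
  move=> x /BA[k _ Akx]; have [_ /(_ x Akx)[c cs cx] _] := sP k.
  exists (pickle (k, index c (s k))).
    by exists (k, index c (s k)) => //=; rewrite /N/= index_mem.
  by move=> i /=; rewrite decK /b/= nth_index//; have /andP[/ltW -> /ltW ->] := cx i.
have vol0 x : 0 <= volume (b x).1 (b x).2.
  by apply: prodr_ge0 => i _; rewrite subr_ge0.
rewrite (@reindex_esum _ _ _ N _ pickle); last first.
  by apply: inj_bij; apply: in2W; exact: (pcan_inj pickleK).
under eq_esum do rewrite decK.
have -> : N = setT `*`` (fun k => `I_(size (s k))).
  by apply/seteqP; split=> -[k j]//= [].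
rewrite -(@esum_esum _ _ _ setT (fun k => `I_(size (s k)))
  (fun k j => (volume (b (k, j)).1 (b (k, j)).2)%:E)); last first.
  by move=> k j _ _; rewrite lee_fin.
apply: le_trans (epsilon_trick0 xpredT (ltW e0)).
rewrite nneseries_esumT; last by move=> k; rewrite lee_fin ltW.
apply: le_esum => k _; have [_ _ sk] := sP k.
rewrite esum_fset//; last by move=> j _; rewrite lee_fin.
rewrite -fsbig_ord sumEFin lee_fin; apply: le_trans sk.
by rewrite (big_nth (0, 0)) big_mkord.
Qed.

(** Every point of [B] is inside a box with rational corners contained in its ball, and there are
    countably many such boxes. *)
Lemma lebesgue_null_local d (B : set 'rV[R]_d) :
  (forall x, B x -> exists2 e, 0 < e & forall l u,
     open_box l u x -> box l u `<=` ball x e ->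
     forall e', 0 < e' -> content_le (B `&` box l u) e') ->
  lebesgue_null B.
Proof.
move=> Bloc.
pose Q (k : nat) : 'rV[rat]_d * 'rV[rat]_d := odflt (0, 0) (unpickle k).
pose K k := B `&` box (map_mx ratr (Q k).1) (map_mx ratr (Q k).2).
(* [A k] is [K k] if that has content zero and is empty otherwise, so every [A k] has content
   zero. *)
pose A k := [set x | K k x /\ forall e', 0 < e' -> content_le (K k) e'].
apply: (@lebesgue_null_bigcup d A) => [k e e0|x Bx].
  have [Kk|nKk] := pselect (forall e', 0 < e' -> content_le (K k) e').
    by apply: (content_le_sub _ (lexx e) (Kk e e0)) => x [].
  by apply: (content_le_sub _ (ltW e0) (content_le0 R d)) => x [].
have [e e0 eP] := Bloc x Bx.
have lex i : exists q : rat, x 0 i - e < ratr q < x 0 i.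
  have [|q] := @rat_in_itvoo R (x 0 i - e) (x 0 i); first by lra.
  by rewrite in_itv/=; exists q.
have gex i : exists q : rat, x 0 i < ratr q < x 0 i + e.
  have [|q] := @rat_in_itvoo R (x 0 i) (x 0 i + e); first by lra.
  by rewrite in_itv/=; exists q.
have [l lP] := choice lex; have [u uP] := choice gex.
exists (pickle (\row_i l i, \row_i u i)) => //.
have KE : K (pickle (\row_i l i, \row_i u i)) =
    B `&` box (map_mx ratr (\row_i l i)) (map_mx ratr (\row_i u i)).
  by rewrite /K /Q pickleK.
rewrite /A/= KE; split.
  split=> // i; rewrite !mxE.
  by have /andP[_ /ltW ->] := lP i; have /andP[/ltW -> _] := uP i.
apply: eP => [i|y lyu].
  by rewrite !mxE; have /andP[_ ->] := lP i; have /andP[-> _] := uP i.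
apply/mx_ballE => // i j; rewrite ord1; have := lyu j; rewrite !mxE.
by have := lP j; have := uP j; rewrite ltr_distl; lra.
Qed.

(** On each small box some [h p] is not identically zero, with [p] depending on the box; the common
    zeros there lie in the zero set of that [h p]. *)
Lemma lebesgue_null_common_zeros d (T : eqType) (f : seq T)
    (h : T -> 'rV[R]_d -> R) (O : set 'rV[R]_d) :
  open O -> (forall p y, O y -> tame_at (h p) y) ->
  (forall y, O y -> ~ \forall z \near y, forall p, p \in f -> h p z = 0) ->
  lebesgue_null [set y | O y /\ forall p, p \in f -> h p y = 0].
Proof.
move=> Oo tame nz; apply: lebesgue_null_local => x [Ox _].
have /nbhs_ballP[e /= e0 eO] := open_nbhs_nbhs (conj Oo Ox).
exists e => // l u lxu lue e' e'0.
have lu i : l 0 i < u 0 i by have /andP[/lt_trans/[apply]] := lxu i.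
have [z [lzu nhz]] : exists z, open_box l u z /\
    ~ forall p, p \in f -> h p z = 0.
  apply: contrapT => /forallNP hz; apply: (nz x Ox).
  have : nbhs x (open_box l u).
    by apply: open_nbhs_nbhs; split=> //; exact: open_box_open.
  apply: (@filterS _ (nbhs x) (nbhs_filter x)) => z lzu.
  by apply: contrapT => nhz; apply: (hz z).
move/existsNP : nhz => [p /not_implyP[pf /eqP hpz]].
have lubox : box l u z by move=> i; have /andP[/ltW -> /ltW ->] := lzu i.
apply: (content_le_sub _ (lexx e') (@zero_set_content _ _ (h p) l u e' lu _ _ e'0)).
- by move=> y [[_ /(_ p pf)]].
- by move=> y /lue/eO/tame.
- by exists z.
Qed.

End NullSets.

(** * Charts *)

Section Charts.
Variables (R : realType) (n : nat).

Definition slice_incl (d : 'I_n.+1) (y : 'rV[R]_d) : 'rV[R]_n :=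
  \row_(i < n) if insub (i : nat) is Some j then y 0 (j : 'I_d) else 0.

Lemma slice_inclK (d : 'I_n.+1) : cancel (@slice_incl d) (@slice_coord R n d).
Proof.
move=> y; apply/rowP => i; rewrite !mxE.
by case: insubP => [j _ ji|]; [congr (y 0 _); exact: val_inj|rewrite /= ltn_ord].
Qed.

Lemma slice_coordK (d : 'I_n.+1) (x : 'rV[R]_n) :
  (forall i : 'I_n, (d <= i)%N -> x 0 i = 0) ->
  slice_incl (slice_coord d x) = x.
Proof.
move=> x0; apply/rowP => i; rewrite !mxE; case: insubP => [j _ ji|].
  by rewrite mxE; congr (x 0 _); exact: val_inj.
by rewrite -leqNgt => /x0.
Qed.

Lemma slice_incl0 (d : 'I_n.+1) (y : 'rV[R]_d) (i : 'I_n) :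
  (d <= i)%N -> slice_incl y 0 i = 0.
Proof. by move=> di; rewrite mxE insubN// -leqNgt. Qed.

Lemma slice_incl_line (d : 'I_n.+1) (y v : 'rV[R]_d) s :
  slice_incl (y + s *: v) = slice_incl y + s *: slice_incl v.
Proof.
apply/rowP => i; rewrite !mxE.
by case: insubP => [j _ _|_]; rewrite ?mxE// mulr0 addr0.
Qed.

Lemma slice_incl_continuous (d : 'I_n.+1) : continuous (@slice_incl d).
Proof.
move=> y A /nbhs_ballP[e /= e0 eA]; apply/nbhs_ballP; exists e => //= z.
move=> /(mx_ballE _ _ e0) yz; apply: eA; apply/mx_ballE => // i j.
by rewrite !mxE; case: insubP => [k _ _|_]; rewrite // subrr normr0.
Qed.

Lemma slice_coord_continuous (d : 'I_n.+1) : continuous (@slice_coord R n d).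
Proof.
move=> x A /nbhs_ballP[e /= e0 eA]; apply/nbhs_ballP; exists e => //= z.
move=> /(mx_ballE _ _ e0) xz; apply: eA; apply/mx_ballE => // i j.
by rewrite !mxE.
Qed.

Lemma ball_segment m (x y z : 'rV[R]_m) e s : 0 < e -> 0 <= s <= 1 ->
  ball x e y -> ball x e z -> ball x e (y + s *: (z - y)).
Proof.
move=> e0 /andP[s0 s1] /(mx_ballE _ _ e0) xy /(mx_ballE _ _ e0) xz.
have conv a b : 0 < a -> 0 < b -> 0 < (1 - s) * a + s * b.
  by move=> a0 b0; have [ab|ba] := leP a b; nra.
apply/mx_ballE => // i j; rewrite !mxE.
move: (xy i j) (xz i j); rewrite !ltr_norml => /andP[xy1 xy2] /andP[xz1 xz2].
have := conv (e + (x i j - y i j)) (e + (x i j - z i j)).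
have := conv (e - (x i j - y i j)) (e - (x i j - z i j)).
by move=> h1 h2; apply/andP; split; lra.
Qed.

Lemma analytic_on_continuous m (V : set 'rV[R]_n) (F : 'rV[R]_n -> 'rV[R]_m) x :
  analytic_on V F -> V x -> {for x, continuous F}.
Proof.
move=> FV Vx A /nbhs_ballP[e /= e0 eA].
have : nbhs x [set z | forall j, `|F x 0 j - F z 0 j| < e].
  apply: (@filter_forall _ _ (fun j z => `|F x 0 j - F z 0 j| < e) (nbhs x)) => j.
  have /(@cvgrPdist_lt _ R _ (nbhs x) (nbhs_filter x)) := analytic_at_continuous (FV x Vx j).
  exact.
apply: (@filterS _ (nbhs x) (nbhs_filter x)) => z xz.
by apply: eA; apply/mx_ballE => // i j; rewrite ord1.
Qed.

Lemma meval_continuous d (F : 'rV[R]_d -> 'rV[R]_n) (p : mpoly n R) x :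
  {for x, continuous F} -> {for x, continuous (fun z => meval (F z 0) p)}.
Proof.
move=> Fx; have Fi i : (fun z => F z 0 i) @ x --> F x 0 i.
  apply: (@continuous_comp _ _ _ F (fun M : 'rV[R]_n => M 0 i)) => //.
  exact: coord_continuous.
rewrite /prop_for /continuous_at mevalE; under eq_fun do rewrite mevalE.
apply: (@cvg_big _ _ _ _ _ _ _ (nbhs x)) => [|m _]; first exact: add_continuous.
apply: cvgM; first exact: (@cvg_cst _ _ _ (nbhs x) (nbhs_filter x)).
apply: (@cvg_big _ _ _ _ _ _ _ (nbhs x)) => [|i _]; first exact: mul_continuous.
exact: (continuous_comp (Fi i) (@exprn_continuous R (m i) _)).
Qed.

(** Lines of the slice map to lines of the chart, along which the coordinates of [Psi] are power
    germs; a polynomial in power germs is one too. Composition of several-variable series is thus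
    avoided. *)
Lemma tame_pullback (d : 'I_n.+1) (V : set 'rV[R]_n)
    (Psi : 'rV[R]_n -> 'rV[R]_n) (p : mpoly n R) (y : 'rV[R]_d) :
  analytic_on V Psi -> V (slice_incl y) ->
  tame_at (fun y => meval (Psi (slice_incl y) 0) p) y.
Proof.
move=> PsiV Vy; split=> [|v].
  apply: (@meval_continuous d (Psi \o @slice_incl d)).
  apply: continuous_comp; first exact: slice_incl_continuous.
  exact: analytic_on_continuous PsiV Vy.
apply: power_germ_null_or_isolated.
apply: (@power_germ_meval _ _ (fun i s => Psi (slice_incl (y + s *: v)) 0 i)) => i.
under eq_fun do rewrite slice_incl_line.
exact: (analytic_at_line _ (PsiV _ Vy i)).
Qed.

Variable f : seq (mpoly n R).

Definition null_germ (C : set 'rV[R]_n) (x : 'rV[R]_n) :=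
  \forall z \near x, C z -> forall p, p \in f -> meval (z 0) p = 0.

Section OneChart.
Variables (d : 'I_n.+1) (C U V : set 'rV[R]_n).
Variables (Phi Psi : 'rV[R]_n -> 'rV[R]_n).
Hypothesis chart : slice_chart d C U V Phi Psi.

Let h p y := meval (Psi (@slice_incl d y) 0) p.
Let O : set 'rV[R]_d := @slice_incl d @^-1` V.

Lemma chart_slice_open : open O.
Proof.
have [[_ Vo] _ _ _ _] := chart.
by apply: open_comp => // y _; exact: slice_incl_continuous.
Qed.

Lemma chart_coordK x : C x -> U x -> slice_incl (slice_coord d (Phi x)) = Phi x.
Proof.
by have [_ _ _ _ CU] := chart => Cx Ux; apply: slice_coordK; exact/CU.
Qed.

Lemma chart_pointK x : C x -> U x ->
  Psi (slice_incl (slice_coord d (Phi x))) = x.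
Proof.
by have [_ _ UV _ _] := chart => Cx Ux; rewrite chart_coordK//; case: (UV x Ux).
Qed.

Lemma chart_slice_mem x : C x -> U x -> O (slice_coord d (Phi x)).
Proof.
have [_ _ UV _ _] := chart => Cx Ux.
by rewrite /O/= chart_coordK//; case: (UV x Ux).
Qed.

Lemma chart_point_mem y : O y -> C (Psi (slice_incl y)) /\ U (Psi (slice_incl y)).
Proof.
have [_ _ _ VU CU] := chart => Oy; have [Uy PhiK] := VU _ Oy.
by split=> //; apply/CU => // i di; rewrite PhiK slice_incl0.
Qed.

(** The chart is a homeomorphism between [O] and the part of [C] in [U]; each direction uses the
    continuity of one of the two maps. *)
Lemma chart_null_germP x : C x -> U x ->
  null_germ C x <->
  \forall y \near slice_coord d (Phi x), forall p, p \in f -> h p y = 0.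
Proof.
move=> Cx Ux; have [[Uo Vo] [PhiU PsiV] UV VU CU] := chart.
pose y0 := slice_coord d (Phi x); have Oy0 : O y0 by exact: chart_slice_mem.
split=> [x0|y00].
  have cPsi : {for y0, continuous (Psi \o @slice_incl d)}.
    apply: continuous_comp; first exact: slice_incl_continuous.
    exact: analytic_on_continuous PsiV Oy0.
  have := cPsi _; rewrite /comp chart_pointK// => /(_ _ x0).
  have nO := open_nbhs_nbhs (conj chart_slice_open Oy0).
  move=> /(filterI nO); apply: (@filterS _ (nbhs y0) (nbhs_filter y0)).
  by move=> y [/chart_point_mem[Cy _] h0] p pf; exact: h0.
have cPhi : {for x, continuous (slice_coord d \o Phi)}.
  apply: continuous_comp; last exact: slice_coord_continuous.
  exact: analytic_on_continuous PhiU Ux.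
have := cPhi _ y00; have nU := open_nbhs_nbhs (conj Uo Ux).
move=> /(filterI nU); apply: (@filterS _ (nbhs x) (nbhs_filter x)).
by move=> z [Uz h0] Cz p pf; have := h0 p pf; rewrite /h/= chart_pointK.
Qed.

(** Read in the chart, [B] lies in a ball inside [O]. Balls are convex, so a null germ at one point
    of the ball spreads along segments to the whole ball. *)
Lemma chart_identity x : C x -> U x -> exists2 B, nbhs x B &
  forall z, B z -> C z -> null_germ C z -> null_germ C x.
Proof.
move=> Cx Ux; have [[Uo Vo] [PhiU PsiV] UV VU CU] := chart.
have Oy0 := chart_slice_mem Cx Ux.
have nO := open_nbhs_nbhs (conj chart_slice_open Oy0).
set y0 := slice_coord d (Phi x) in Oy0 nO.
have [e e0 eO] := iffLR (nbhs_ballP _ _) nO.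
have cPhi : {for x, continuous (slice_coord d \o Phi)}.
  apply: continuous_comp; last exact: slice_coord_continuous.
  exact: analytic_on_continuous PhiU Ux.
have nU := open_nbhs_nbhs (conj Uo Ux).
exists (U `&` ((slice_coord d \o Phi) @^-1` ball y0 e)).
  by apply: filterI => //; apply: cPhi; exact: nbhsx_ballx.
move=> z [Uz /= y0z] Cz /(chart_null_germP Cz Uz) y10.
apply/(chart_null_germP Cx Ux); apply/nbhs_ballP; exists e => // w y0w p pf.
set y1 := slice_coord d (Phi z) in y0z y10.
apply: (@tame_identity _ _ (h p) y1) => [s /andP[s0 s1]|].
  apply: tame_pullback PsiV _; apply: eO.
  by apply: ball_segment => //; apply/andP.
have line : (fun s : R => y1 + s *: (w - y1)) @ (0 : R) --> y1 + 0 *: (w - y1).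
  apply: (@cvgD _ _ _ (nbhs (0 : R)) _); first exact: cvg_cst.
  by apply: cvgZr_tmp; exact: cvg_id.
rewrite scale0r addr0 in line.
by apply: (@filterS _ (nbhs (0 : R)) _ _ _ _ (line _ y10)) => s /(_ p pf).
Qed.

End OneChart.

(** The points of [C] with null germ form a nonempty subset, open in [C] by definition of a germ and
    closed in [C] by [chart_identity]. *)
Lemma connected_identity (C : set 'rV[R]_n) x0 :
  connected C -> analytic_submanifold C -> C x0 -> null_germ C x0 ->
  forall x, C x -> forall p, p \in f -> meval (x 0) p = 0.
Proof.
move=> Ccon [d Cchart] Cx0 nx0.
pose S := C `&` [set x | null_germ C x].
suff <- : S = C.
  by move=> x [Cx nx]; exact: (nbhs_singleton nx).
apply: Ccon; first by exists x0.
  exists (interior [set z | C z -> forall p, p \in f -> meval (z 0) p = 0]) => //.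
  exact: open_interior.
exists (closure S); first exact: closed_closure.
apply/seteqP; split=> [x Sx|x [Cx clx]].
  by split; [case: Sx|exact: subset_closure].
split=> //=; have [U [V [Phi [Psi [Ux chart]]]]] := Cchart x Cx.
have [B nB BP] := chart_identity chart Cx Ux.
by have [z [[Cz nz] Bz]] := clx B nB; exact: BP nz.
Qed.

(** If all polynomials of [f] vanished near one point of the slice, the identity principle would
    make them vanish on all of [C]. *)
Lemma null_in_common_zeros (C N : set 'rV[R]_n) :
  connected C -> analytic_submanifold C ->
  (exists2 x, C x & ~ forall p, p \in f -> meval (x 0) p = 0) ->
  C `&` N `<=` [set x | forall p, p \in f -> meval (x 0) p = 0] ->
  null_in C N.
Proof.
move=> Ccon Cman [x1 Cx1 nx1] Nf d U V Phi Psi chart.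
have [[Uo Vo] [PhiU PsiV] UV VU CU] := chart.
have null_sub (A B : set 'rV[R]_d) : A `<=` B -> lebesgue_null B -> lebesgue_null A.
  move=> AB Bn e /Bn[D [l [u [? BD ?]]]]; exists D, l, u.
  by split=> //; exact: subset_trans BD.
apply: (null_sub _ _ _ (@lebesgue_null_common_zeros R d _ f
  (fun p y => meval (Psi (slice_incl y) 0) p) (@slice_incl d @^-1` V) _ _ _)).
- move=> _ [x [[Nx Cx] Ux] <-]; split; first exact: (chart_slice_mem chart).
  by move=> p pf /=; rewrite (chart_pointK chart)//; apply: Nf.
- exact: (chart_slice_open chart).
- by move=> p y Vy; exact: tame_pullback PsiV Vy.
- move=> y Vy y0; have [Cy Uy] := chart_point_mem chart Vy.
  have [_ PhiK] := VU _ Vy.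
  apply: nx1; apply: (connected_identity Ccon Cman Cy _ Cx1).
  apply/(chart_null_germP chart Cy Uy).
  by rewrite PhiK slice_inclK.
Qed.

End Charts.

(** * The exceptional set and the conclusion *)

Theorem theorem5p1 (R : realType) (n : nat) (g f : seq (mpoly n R))
    (g_manifold : forall C : set 'rV[R]_n,
        components (real_zeros g) C -> analytic_submanifold C) :
  for_almost_all_witness_sets (real_zeros g)
    (fun W : set 'rV[R]_n =>
       (forall x, W x -> forall p, p \in f -> meval (x 0) p = 0) ->
       real_zeros g `<=` real_zeros f).
Proof.
set Z := real_zeros g.
exists [set x | real_zeros f x /\
  ~ (connected_component Z x `<=` real_zeros f)]; split=> [C CZ|W _ Wgen Wf x Zx].
  have [x Zx CE] := CZ; have Cman := g_manifold C CZ.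
  have Ccon : connected C by rewrite -CE; exact: component_connected.
  have [Cf|nCf] := pselect (C `<=` real_zeros f); last first.
    apply: (null_in_common_zeros (f := f)) => // [|y [_ []]//].
    by move/existsNP : nCf => [y /not_implyP[Cy nfy]]; exists y.
  (* If [C] lies in the zeros of [f], the exceptional set misses [C], because [C] is the component
     of each of its points; the empty cover suffices. *)
  move=> d U V Phi Psi _ e e0; exists set0, (fun=> 0), (fun=> 0); split=> //.
    move=> z [y [[[_ nC] Cy] _] _]; exfalso; apply: nC.
    by move: Cy; rewrite -CE => /same_connected_component <-; rewrite CE.
  by rewrite esum_set0 lee_fin ltW.
have Cx : components Z (connected_component Z x) by exists x.
have [p [Wp Cp np]] := Wgen _ Cx.
(* Were [x] not a zero of [f], the zero [p] of [f] in the same component would be exceptional. *)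
apply: contrapT => nfx; apply: np; split; first exact: Wf.
rewrite -(same_connected_component Cp) => /(_ x); apply: contra_not nfx; apply.
exact: connected_component_refl.
Qed.
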